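(* There exist $q_1,q_2\in L_{1,1}$ and a function $h\in L^1(\mathbb{R}_+)$, $h\neq0$, such that $$\int_0^\infty h(x)\varphi_1(x,k)\varphi_2(x,k)\,dx=0\qquad\text{for all } k>0,$$ where $\varphi_j(x,k)$ is the regular solution corresponding to $q_j$, $j=1,2$.
   Context: $\mathbb{R}_+=[0,\infty)$. $L_{1,1}$ is the set of real-valued functions $q$ on $\mathbb{R}_+$ with $\int_0^\infty(1+x)|q(x)|\,dx<\infty$ and $q\in L^2(0,a)$ for every $a<\infty$. The regular solution $\varphi(x,k)$ corresponding to $q$ is the unique solution of $-\varphi''+q(x)\varphi=k^2\varphi$, $x>0$, $\varphi(0,k)=0$, $\varphi'(0,k)=1$ (prime denotes $d/dx$). *)

(* Defs.v *)
From mathcomp Require Import all_boot all_order all_algebra.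
From mathcomp Require Import all_classical all_reals all_analysis.

Set Implicit Arguments.
Unset Strict Implicit.
Unset Printing Implicit Defensive.

Import Order.TTheory GRing.Theory Num.Theory.
Import numFieldNormedType.Exports.

Local Open Scope classical_set_scope.
Local Open Scope ring_scope.

(* Functions on the half-line [0, +oo[ are encoded as total functions R -> R;
   no definition below depends on their values at negative points. *)

Definition L11 (R : realType) (q : R -> R) : Prop :=
  [/\ measurable_fun (`[0, +oo[%classic : set R) q,
      (\int[@lebesgue_measure R]_(x in `[0%R, +oo[) ((1 + x) * `|q x|)%:E
         < +oo)%E
    & forall a : R,
        (\int[@lebesgue_measure R]_(x in `]0%R, a[) (`|q x| ^+ 2)%:E < +oo)%E].

Definition L1 (R : realType) (h : R -> R) : Prop :=
  (@lebesgue_measure R).-integrable `[0, +oo[ (EFin \o h).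

Definition null_on_halfline (R : realType) (h : R -> R) : Prop :=
  {ae @lebesgue_measure R, forall x, 0 <= x -> h x = 0}.

Definition abs_continuous_on (R : realType) (a b : R) (f : R -> R) : Prop :=
  forall e : R, 0 < e -> exists2 d : R, 0 < d &
    forall (n : nat) (l r : 'I_n -> R),
      (forall i, [/\ a <= l i, l i <= r i & r i <= b]) ->
      trivIset setT (fun i => `]l i, r i[%classic) ->
      \sum_(i < n) (r i - l i) < d ->
      \sum_(i < n) `|f (r i) - f (l i)| < e.

(* At 0 the derivative is the one from the right. *)
Definition derivative_on_halfline (R : realType) (f df : R -> R) : Prop :=
  (forall x : R, 0 < x -> is_derive x 1 f (df x)) /\
  (f t - f 0) / t @[t --> 0^'+] --> df 0.

(* Since q is only locally square integrable, solutions are taken in the sense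
   of Caratheodory: phi' is locally absolutely continuous on [0, +oo[ and the
   equation holds for almost every x > 0. *)
Definition solves_regular_ivp (R : realType) (q : R -> R) (k : R)
    (phi : R -> R) : Prop :=
  exists dphi : R -> R,
  [/\ derivative_on_halfline phi dphi,
      forall a : R, 0 < a -> abs_continuous_on 0 a dphi,
      {ae @lebesgue_measure R, forall x, 0 < x ->
         derivable dphi x 1 /\
         - 'D_1 dphi x + q x * phi x = k ^+ 2 * phi x},
      phi 0 = 0
    & dphi 0 = 1].

Definition regular_solution (R : realType) (q : R -> R) (k : R)
    (phi : R -> R) : Prop :=
  solves_regular_ivp q k phi /\
  forall psi : R -> R, solves_regular_ivp q k psi ->
    forall x : R, 0 <= x -> psi x = phi x.

(* Main.v *)
Require Import Defs.
From mathcomp Require Import all_boot all_order all_algebra.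
From mathcomp Require Import ring lra.
From mathcomp Require Import all_classical all_reals all_analysis.
From mathcomp Require Import measurable_realfun.

(* Let [q1 = q2 = q] have a bound state: a solution [psi] of
   [- psi'' + q psi = - psi] that vanishes at 0 and decays at infinity.  Then
   [h = (psi ^ 2)'] is orthogonal to every [phi ^ 2]: with the Wronskian
   [W = psi phi' - psi' phi], which satisfies [W' = - (1 + k ^ 2) psi phi],
     [h phi ^ 2 = (1/2) (psi ^ 2 phi ^ 2 + W ^ 2 / (1 + k ^ 2))'],
   and the function on the right vanishes at 0 and at infinity.  We take
   [q = - 6 sech ^ 2], for which [psi = tanh sech], and [phi] is an explicit
   combination of [sin (k x)] and [cos (k x)] with coefficients in [tanh x].
   Uniqueness of [phi] among Caratheodory solutions rests on the mean value
   inequality for absolutely continuous functions. *)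

Set Implicit Arguments.
Unset Strict Implicit.
Unset Printing Implicit Defensive.

Import Order.TTheory GRing.Theory Num.Theory.
Import numFieldNormedType.Exports.
Local Open Scope classical_set_scope.
Local Open Scope ring_scope.

(** * Mean value inequality for absolutely continuous functions *)

(** At the supremum of the points of the segment satisfying [P], the step leads from a point just
    below to [y], the smaller of [b] and a point beyond. As [y] cannot exceed the supremum,
    [y = b]. *)
Lemma segment_induction (R : realType) (P : R -> Prop) (a b : R) :
  a <= b -> P a ->
  (forall s, a <= s <= b -> exists2 eta, 0 < eta & forall x y,
     a <= x -> s - eta < x -> x <= s -> s <= y -> y < s + eta -> y <= b ->
     P x -> P y) ->
  P b.
Proof.
move=> ab Pa step; pose A := [set x | a <= x <= b /\ P x].
have Aa : A a by split=> //; rewrite lexx.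
have supA : has_sup A.
  by split; [exists a|exists b => x [/andP[]]].
have le_supA x : A x -> x <= sup A by move=> Ax; apply: ub_le_sup => //; case: supA.
have sAb : a <= sup A <= b.
  rewrite le_supA//=; apply: ge_sup; first by exists a.
  by move=> x [/andP[]].
have [eta eta0 stepA] := step _ sAb.
have [x [/andP[ax xb] Px] ltx] := sup_adherent eta0 supA.
have /andP[asA sAleb] := sAb.
pose y := Num.min b (sup A + eta / 2).
have sy : sup A <= y by rewrite /y le_min sAleb/=; lra.
have Py : P y.
  apply: (stepA x) => //; first by apply: le_supA; split; rewrite ?ax.
    by rewrite /y gt_min; apply/orP; right; lra.
  by rewrite /y ge_min lexx.
have : y <= sup A.
  by apply: le_supA; split=> //; rewrite (le_trans asA sy)/= /y ge_min lexx.
by move: Py; rewrite /y; case: (leP b) => // _ _; lra.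
Qed.

Lemma is_derive_lipschitz_at (R : realType) (f : R -> R) (x l K : R) :
  is_derive x 1 f l -> `|l| < K ->
  exists2 eta, 0 < eta &
    forall y, `|y - x| < eta -> `|f y - f x| <= K * `|y - x|.
Proof.
move=> [df dfl] lK.
have : h^-1 *: (f (h *: 1 + x) - f x) @[h --> 0^'] --> l.
  by rewrite -dfl; exact: df.
(* The gap between [|l|] and [K] is the tolerance for the difference quotient. *)
move=> /cvgrPdist_lt /(_ (K - `|l|)); rewrite subr_gt0 => /(_ lK).
move=> [eta /= eta0 H]; exists eta => // y yx.
have [->|neq] := eqVneq y x; first by rewrite !subrr normr0 mulr0.
have yx0 : y - x != 0 by rewrite subr_eq0.
have := H (y - x); rewrite /ball_ /= sub0r normrN => /(_ yx yx0).
rewrite /GRing.scale /= mulr1 subrK => Hl.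
rewrite -ler_pdivrMr ?normr_gt0// -normfV -normrM mulrC.
rewrite -[X in `|X|](subKr l) ltW// (le_lt_trans (ler_normB _ _))//.
by rewrite addrC -ltrBrDr.
Qed.

Lemma trivIset_itv_chain (R : realType) (n : nat) (l r : 'I_n -> R) :
  (forall i j : 'I_n, (i < j)%N -> r i <= l j) ->
  trivIset setT (fun i => `]l i, r i[%classic).
Proof.
move=> rl i j _ _ [x []] /=; rewrite !in_itv/= => /andP[lix xri] /andP[ljx xrj].
apply/val_inj; case: (ltngtP i j) => //= ij; exfalso; have {ij} := rl _ _ ij; lra.
Qed.

(** The total length is the measure of a disjoint union contained in [U]. This is how a small open
    cover meets the smallness condition of [abs_continuous_on]. *)
Lemma sum_length_itv_le (R : realType) (n : nat) (l r : 'I_n -> R) (U : set R) (d : R) :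
  (forall i, l i <= r i) -> trivIset setT (fun i => `]l i, r i[%classic) ->
  (forall i, `]l i, r i[ `<=` U) -> measurable U ->
  (@lebesgue_measure R U < d%:E)%E -> \sum_(i < n) (r i - l i) < d.
Proof.
move=> lr tI lrU mU Ud; rewrite -lte_fin (le_lt_trans _ Ud)// -sumEFin.
rewrite (eq_bigr (fun i => @lebesgue_measure R `]l i, r i[)); last first.
  move=> i _; rewrite lebesgue_measure_itv/= lte_fin; case: ltP => // ril.
  by congr EFin; apply/eqP; rewrite subr_eq0 eq_le ril lr.
rewrite -(@measure_bigsetU_ord _ _ _ (@lebesgue_measure R) n xpredT
  (fun i => `]l i, r i[%classic))//.
apply: le_measure; rewrite ?inE//; first exact: bigsetU_measurable.
by apply: (big_ind (fun A => A `<=` U)) => [x []|A B AU BU x [/AU|/BU]|i _].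
Qed.

(* The exceptional points are covered by an open set [U] so small that absolute
   continuity bounds the increments of [f] over disjoint intervals inside [U];
   [P x] says that the increment over [[a, x]] is controlled up to such
   intervals, and propagates along the segment. *)
Lemma abs_continuous_lipschitz_step (R : realType) (a b K e : R) (f : R -> R) :
  a <= b -> 0 <= K -> 0 < e -> abs_continuous_on a b f ->
  {ae @lebesgue_measure R, forall x : R, a < x -> x < b ->
     exists2 l, is_derive x 1 f l & `|l| <= K} ->
  `|f b - f a| <= (K + e) * (b - a) + e.
Proof.
move=> ab K0 e0 acf aef; have [d d0 acfd] := acf e e0.
pose bad := [set x : R | a <= x <= b /\ ~ exists2 l, is_derive x 1 f l & `|l| <= K].
have badN : (@lebesgue_measure R).-negligible bad.
  (* Nothing is assumed at [a] and [b], so they may be bad; single points are negligible. *)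
  have badS : bad `<=` ~` [set x : R | a < x -> x < b ->
     exists2 l, is_derive x 1 f l & `|l| <= K] `|` ([set a] `|` [set b]).
    move=> x [/andP[ax xb] nx]; have [->|xa] := eqVneq x a; first by right; left.
    have [->|xb'] := eqVneq x b; first by right; right.
    by left => /= /(_ _ _)/nx; apply; rewrite lt_neqAle ?ax ?xb// ?xb' ?andbT// eq_sym.
  apply: (@negligibleS _ _ _ (@lebesgue_measure R) _ _ badS).
  apply: (@negligibleU _ _ _ (@lebesgue_measure R)); first exact: aef.
  apply: (@negligibleU _ _ _ (@lebesgue_measure R)); apply/negligibleP => //;
    exact: lebesgue_measure_set1.
have [U [oU badU mUd]] := @outer_measure_open_le R bad _ (divr_gt0 d0 (ltr0Sn R 1)).
have {}mUd : (@lebesgue_measure R U < d%:E)%E.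
  rewrite (le_lt_trans mUd)//; move/negligible_outer_measure : badN => ->.
  by rewrite add0e lte_fin; lra.
pose P x := exists n (l r : nat -> R),
  [/\ forall i, (i < n)%N -> [/\ a <= l i, l i <= r i, r i <= x
                                & `]l i, r i[ `<=` U],
      forall i j, (i < j)%N -> (j < n)%N -> r i <= l j
    & `|f x - f a| <= (K + e) * (x - a) + \sum_(i < n) `|f (r i) - f (l i)|].
suff [n [l [r [lrb rl fab]]]] : P b.
  rewrite (le_trans fab)// lerD2l ltW//.
  have tI : trivIset setT (fun i : 'I_n => `]l i, r i[%classic).
    by apply: trivIset_itv_chain => i j ij; apply: rl.
  apply: (acfd n (fun i => l i) (fun i => r i)) => //.
    by move=> i; have [] := lrb i (ltn_ord i).
  apply: (@sum_length_itv_le _ _ _ _ U) => //; last exact: open_measurable.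
    by move=> i; have [] := lrb i (ltn_ord i).
  by move=> i; have [] := lrb i (ltn_ord i).
apply: (@segment_induction _ P a b) => //.
  by exists 0%N, (fun=> 0), (fun=> 0); split=> //; rewrite !subrr mulr0 big_ord0 normr0 add0r.
move=> s /andP[als sb].
have [[l dl lK]|nl] := pselect (exists2 l, is_derive s 1 f l & `|l| <= K).
(* At a good point the list of intervals is kept: the increments of [f] on both sides of [s] have
   slope at most [K + e] and go into the linear term. *)
- have lKe : `|l| < K + e by lra.
  have [eta eta0 feta] := is_derive_lipschitz_at dl lKe.
  exists eta => // x y ax sx xs sy ys yb [n [u [v [uvb vu fxa]]]].
  exists n, u, v; split=> //.
    by move=> i /uvb[aui uvi vix uvU]; split=> //; lra.
  have fys : `|f y - f s| <= (K + e) * (y - s).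
    by have := feta y; rewrite ger0_norm ?subr_ge0//; apply; lra.
  have fxs : `|f x - f s| <= (K + e) * (s - x).
    by have := feta x; rewrite ler0_norm ?subr_le0// opprB; apply; lra.
  rewrite (_ : f y - f a = (f y - f s) - (f x - f s) + (f x - f a)); last by ring.
  rewrite (le_trans (ler_normD _ _))// (le_trans (lerD (ler_normB _ _) (lexx _)))//.
  lra.
(* At a bad point []x, y[] lies in [U] and is appended to the list, so the increment of [f] goes
   into the sum. *)
- have sU : U s by apply: badU; split; rewrite ?als.
  have /nbhs_ballP[eta /= eta0 sbU] : nbhs s U by apply: open_nbhs_nbhs.
  exists eta => // x y ax sx xs sy ys yb [n [u [v [uvb vu fxa]]]].
  exists n.+1, (fun i => if i == n then x else u i), (fun i => if i == n then y else v i).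
  split.
  + move=> i; rewrite ltnS leq_eqVlt; case: eqVneq => [_ _|_ /= /uvb[aui uvi vix uvU]].
      split=> //; first lra.
      by move=> z /=; rewrite in_itv/= => /andP[xz zy]; apply: sbU;
        rewrite /ball/= ltr_norml; lra.
    by split=> //; lra.
  + move=> i j ij; rewrite ltnS => jn; have /ltn_eqF -> : (i < n)%N by exact: leq_trans jn.
    case: eqVneq => [ji|jn']; first by have [] := uvb i (leq_trans ij jn).
    by apply: vu => //; rewrite ltn_neqAle jn'.
  + rewrite big_ord_recr/= eqxx.
    under eq_bigr => i _ do rewrite (ltn_eqF (ltn_ord i)).
    rewrite (_ : f y - f a = (f x - f a) + (f y - f x)); last by ring.
    rewrite (le_trans (ler_normD _ _))// addrA lerD2r (le_trans fxa)// lerD2r.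
    by rewrite ler_wpM2l//; lra.
Qed.

Lemma abs_continuous_lipschitz (R : realType) (a b K : R) (f : R -> R) :
  a <= b -> 0 <= K -> abs_continuous_on a b f ->
  {ae @lebesgue_measure R, forall x : R, a < x -> x < b ->
     exists2 l, is_derive x 1 f l & `|l| <= K} ->
  `|f b - f a| <= K * (b - a).
Proof.
move=> ab K0 acf aef; apply/ler_addgt0Pr => e e0.
have c0 : 0 < b - a + 1 by lra.
(* With tolerance [e / (b - a + 1)] the two error terms add up to exactly [e]. *)
have := abs_continuous_lipschitz_step ab K0 (divr_gt0 e0 c0) acf aef.
by rewrite mulrDl -addrA -[X in _ + (_ + X)]mulr1 -mulrDr divfK ?gt_eqF.
Qed.

(** * Restriction, difference and Lipschitz criterion for absolute continuity *)

Lemma abs_continuous_onW (R : realType) (a b c d : R) (f : R -> R) :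
  a <= c -> d <= b -> abs_continuous_on a b f -> abs_continuous_on c d f.
Proof.
move=> ac db acf e /acf[del del0 H]; exists del => // n l r lr.
by apply: H => i; have [cl -> rd] := lr i; split=> //; lra.
Qed.

Lemma abs_continuous_onB (R : realType) (a b : R) (f g : R -> R) :
  abs_continuous_on a b f -> abs_continuous_on a b g ->
  abs_continuous_on a b (fun x => f x - g x).
Proof.
move=> acf acg e e0; have e20 : 0 < e / 2 by lra.
have [df df0 Hf] := acf _ e20; have [dg dg0 Hg] := acg _ e20.
exists (Num.min df dg); first by rewrite lt_min df0.
move=> n l r lr tI; rewrite lt_min => /andP[sf sg].
have {}Hf := Hf n l r lr tI sf; have {}Hg := Hg n l r lr tI sg.
apply: (@le_lt_trans _ _ (\sum_(i < n) `|f (r i) - f (l i)| +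
                          \sum_(i < n) `|g (r i) - g (l i)|)); last lra.
rewrite -big_split/= ler_sum// => i _.
by rewrite (le_trans _ (ler_normB _ _))// [leLHS](_ : _ =
  `|f (r i) - f (l i) - (g (r i) - g (l i))|)//; congr `|_|; ring.
Qed.

Lemma lipschitz_abs_continuous (R : realType) (a b K : R) (f : R -> R) :
  0 <= K ->
  (forall x y, a <= x -> x <= y -> y <= b -> `|f y - f x| <= K * (y - x)) ->
  abs_continuous_on a b f.
Proof.
move=> K0 lipf e e0; have K1 : 0 < K + 1 by lra.
exists (e / (K + 1)); first exact: divr_gt0.
move=> n l r lr _; rewrite ltr_pdivlMr// => lt_e.
apply: (le_lt_trans _ lt_e); rewrite mulr_suml ler_sum// => i _.
have [al lri rb] := lr i; rewrite (le_trans (lipf _ _ al lri rb))// mulrC.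
by rewrite ler_wpM2l ?subr_ge0//; lra.
Qed.

(** * Uniqueness of the regular solution for bounded potentials *)

Lemma derivative_on_halfline_cvg0 (R : realType) (f df : R -> R) :
  derivative_on_halfline f df -> f t @[t --> 0^'+] --> f 0.
Proof.
move=> [_ cf].
have cid : (t : R) @[t --> 0^'+] --> (0 : R) by apply: cvg_at_right_filter; exact: cvg_id.
have : (f t - f 0) / t * t + f 0 @[t --> 0^'+] --> df 0 * 0 + f 0.
  by apply: cvgD; [exact: cvgM|exact: cvg_cst].
rewrite mulr0 add0r; apply: cvg_trans; apply: near_eq_cvg; near=> t.
by rewrite divfK ?subrK// gt_eqF.
Unshelve. all: by end_near. Qed.

Lemma derivative_on_halfline_continuous (R : realType) (f df : R -> R) (a b : R) :
  derivative_on_halfline f df -> 0 <= a -> a < b ->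
  {within `[a, b], continuous f}.
Proof.
move=> hf a0 ab; have cf0 := derivative_on_halfline_cvg0 hf.
have cf x : 0 < x -> {for x, continuous f}.
  by move=> /(hf.1 x)[dfx _]; exact/differentiable_continuous/derivable1_diffP.
apply/continuous_within_itvP => //; split.
- by move=> x; rewrite in_itv/= => /andP[ax _]; apply: cf; lra.
- case: (eqVneq a 0) => [->//|an0]; apply: cvg_at_right_filter; apply: cf.
  by rewrite lt_neqAle eq_sym an0.
- by apply: cvg_at_left_filter; apply: cf; lra.
Qed.

(* On an interval of length [r] the maximum [m] of [|D|] satisfies
   [m <= M * r ^ 2 * m]. *)
Lemma second_order_zero_step (R : realType) (M r a : R) (D E : R -> R) :
  0 <= M -> 0 < r -> M * r ^+ 2 < 1 -> 0 <= a -> D a = 0 -> E a = 0 ->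
  derivative_on_halfline D E -> abs_continuous_on a (a + r) E ->
  {ae @lebesgue_measure R, forall x : R, 0 < x ->
     exists2 l, is_derive x 1 E l & `|l| <= M * `|D x|} ->
  forall x, a <= x -> x <= a + r -> D x = 0 /\ E x = 0.
Proof.
move=> M0 r0 Mr a0 Da Ea dD acE aeE.
have ar : a < a + r by rewrite ltrDl.
have cD := derivative_on_halfline_continuous dD a0 ar.
have cnD : {within `[a, a + r], continuous (fun x => `|D x|)}.
  by move=> x; apply: continuous_comp; [exact: cD|exact: norm_continuous].
have [c] := EVT_max (ltW ar) cnD.
rewrite in_itv/= => /andP[ac cr] maxD.
have m0 : 0 <= `|D c| by [].
(* [E] vanishes at [a] and its derivative is almost everywhere at most [M * |D c|], so the mean
   value inequality applies; a second integration, by the classical mean value theorem, then bounds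
   [D c]. *)
have Ebd x : a <= x -> x <= a + r -> `|E x| <= M * `|D c| * (x - a).
  move=> ax xr; rewrite -[E x]subr0 -[in X in _ - X]Ea.
  apply: abs_continuous_lipschitz => //; first exact: mulr_ge0.
    by apply: abs_continuous_onW acE; lra.
  apply: (@filterS _ _ (ae_filter_ringOfSetsType (@lebesgue_measure R))
    _ _ _ aeE) => y Hy ay yx.
  have [|l dl lD] := Hy; first lra.
  exists l => //; rewrite (le_trans lD)// ler_wpM2l// maxD// in_itv/=; lra.
have Dc0 : `|D c| = 0.
  case: (eqVneq c a) => [->|ca]; first by rewrite Da normr0.
  have {}ca : a < c by rewrite lt_neqAle eq_sym ca.
  have dDc z : z \in `]a, c[ -> is_derive z 1 D (E z).
    by rewrite in_itv/= => /andP[az _]; apply: dD.1; lra.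
  have [z] := MVT ca dDc (derivative_on_halfline_continuous dD a0 ca).
  rewrite in_itv/= Da subr0 => /andP[az zc] Dce.
  have : `|D c| <= M * r ^+ 2 * `|D c|.
    rewrite {1}Dce normrM (ger0_norm (_ : 0 <= c - a)); last lra.
    rewrite (@le_trans _ _ (M * `|D c| * r * r))//; last by rewrite expr2; lra.
    have MD0 : 0 <= M * `|D c| by exact: mulr_ge0.
    apply: ler_pM => //; [lra| |lra].
    by rewrite (le_trans (Ebd _ _ _))// ?ler_wpM2l//; lra.
  nra.
move=> x ax xr; split; apply/normr0_eq0/eqP; rewrite eq_le normr_ge0 andbT.
  by rewrite -Dc0 maxD// in_itv/= ax.
by rewrite (le_trans (Ebd _ ax xr))// Dc0 mulr0 mul0r.
Qed.

(** The half-line is covered by steps of length [r = 1 / (M + 1)], for which [M * r ^ 2 < 1]. Each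
    step returns [D = E = 0] at its right end, the initial data of the next one. *)
Lemma second_order_zero (R : realType) (M : R) (D E : R -> R) :
  0 <= M -> D 0 = 0 -> E 0 = 0 -> derivative_on_halfline D E ->
  (forall a, 0 < a -> abs_continuous_on 0 a E) ->
  {ae @lebesgue_measure R, forall x : R, 0 < x ->
     exists2 l, is_derive x 1 E l & `|l| <= M * `|D x|} ->
  forall x, 0 <= x -> D x = 0.
Proof.
move=> M0 D0 E0 dD acE aeE; pose r := (M + 1)^-1.
have M1 : 0 < M + 1 by lra.
have r0 : 0 < r by rewrite invr_gt0.
have Mr : M * r ^+ 2 < 1.
  rewrite exprVn ltr_pdivrMr ?exprn_gt0// mul1r; nra.
have H n x : 0 <= x -> x <= r * n%:R -> D x = 0 /\ E x = 0.
  elim: n x => [|n IH] x x0.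
    by rewrite mulr0 => xle0; have -> : x = 0 by lra.
  rewrite -natr1 mulrDr mulr1 => xr.
  have rn0 : 0 <= r * n%:R by rewrite mulr_ge0// ltW.
  have [/IH|/ltW rx] := leP x (r * n%:R); first exact.
  have [Dn En] := IH _ rn0 (lexx _).
  apply: (@second_order_zero_step _ M r (r * n%:R)) => //.
  by apply: (abs_continuous_onW rn0 (lexx _)); apply: acE; lra.
move=> x x0; have /(H (Num.truncn (x / r)).+1 x x0)[]// : x <= r * (Num.truncn (x / r)).+1%:R.
by rewrite mulrC -ler_pdivrMr// ltW// truncnS_gt.
Qed.

(** The difference [D] of two solutions has zero initial data and satisfies [D'' = (q - k ^ 2) D]
    almost everywhere, hence [|D''| <= (B + k ^ 2) |D|]. *)
Lemma regular_ivp_unique (R : realType) (q : R -> R) (B k : R) (phi psi : R -> R) :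
  0 <= B -> (forall x, 0 < x -> `|q x| <= B) ->
  solves_regular_ivp q k phi -> solves_regular_ivp q k psi ->
  forall x, 0 <= x -> psi x = phi x.
Proof.
move=> B0 qB [df [hf acf aef f0 df0]] [dg [hg acg aeg g0 dg0]] x x0.
apply/eqP; rewrite -subr_eq0; apply/eqP.
apply: (@second_order_zero _ (B + k ^+ 2) (fun x => psi x - phi x)
  (fun x => dg x - df x)) => //.
- by rewrite addr_ge0// sqr_ge0.
- by rewrite f0 g0 subrr.
- by rewrite df0 dg0 subrr.
- split.
    by move=> y y0; apply: is_deriveB; [exact: hg.1|exact: hf.1].
  rewrite (_ : (fun t => _) =
    (fun t => (psi t - psi 0) / t - (phi t - phi 0) / t)); last first.
    by apply/funext => t; rewrite -mulrBl; congr (_ / _); ring.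
  by apply: cvgB; [exact: hg.2|exact: hf.2].
- by move=> a a0; apply: abs_continuous_onB; [exact: acg|exact: acf].
- apply: (@filterS2 _ _ (ae_filter_ringOfSetsType (@lebesgue_measure R))
    _ _ _ _ aef aeg) => y Hf Hg y0.
  have [ddf ef] := Hf y0; have [ddg eg] := Hg y0.
  exists ('D_1 dg y - 'D_1 df y).
    by apply: is_deriveB; exact/derivableP.
  have -> : 'D_1 dg y - 'D_1 df y = (q y - k ^+ 2) * (psi y - phi y) by lra.
  rewrite normrM ler_wpM2r// (le_trans (ler_normB _ _))// (ger0_norm (sqr_ge0 k)).
  by rewrite lerD2r qB.
Qed.

(** * Classical solutions as Caratheodory solutions *)

Lemma is_derive_continuous (R : realType) (f df : R -> R) :
  (forall x : R, is_derive x 1 f (df x)) -> continuous f.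
Proof.
by move=> dfE x; have [dfx _] := dfE x;
  exact/differentiable_continuous/derivable1_diffP.
Qed.

Lemma is_derive_derivative_on_halfline (R : realType) (f df : R -> R) :
  (forall x : R, is_derive x 1 f (df x)) -> derivative_on_halfline f df.
Proof.
move=> dfE; split=> [x _|]; first exact: dfE.
have [cf <-] := dfE 0.
rewrite (_ : (fun t => _) = (fun t : R => t^-1 *: (f (t *: 1 + 0) - f 0))); last first.
  by apply/funext => t; rewrite /GRing.scale/= mulr1 addr0 mulrC.
exact: cvg_dnbhs_at_right cf.
Qed.

(** The bound [K] on the second derivative makes [dphi] Lipschitz, hence absolutely continuous. *)
Lemma solves_regular_ivp_classical (R : realType) (q : R -> R) (k K : R)
    (phi dphi : R -> R) :
  (forall x : R, is_derive x 1 phi (dphi x)) ->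
  (forall x : R, is_derive x 1 dphi ((q x - k ^+ 2) * phi x)) ->
  (forall x, `|(q x - k ^+ 2) * phi x| <= K) ->
  phi 0 = 0 -> dphi 0 = 1 -> solves_regular_ivp q k phi.
Proof.
move=> dphiE ddphiE ddphiK phi0 dphi0; exists dphi; split=> //.
- exact: is_derive_derivative_on_halfline.
- move=> a _; apply: (@lipschitz_abs_continuous _ _ _ K).
    exact: le_trans (normr_ge0 _) (ddphiK 0).
  move=> x y _ xy _.
  have [|z _ ->] := MVT_segment xy (fun z _ => ddphiE z).
    by apply: continuous_subspaceT; exact: is_derive_continuous ddphiE.
  by rewrite normrM (ger0_norm (_ : 0 <= y - x)) ?subr_ge0// ler_wpM2r ?subr_ge0.
- apply: aeW => x _; have [dd ->] := ddphiE x; split=> //; ring.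
Qed.

(** * Integrals over the half-line of exponentially dominated functions *)

Section exponential_decay.
Variable R : realType.
Let mu := @lebesgue_measure R.

Lemma continuous_expRN (C : R) : continuous (fun x : R => C * expR (- x)).
Proof.
move=> x; apply: cvgM; first exact: cvg_cst.
by apply: (@continuous_comp _ _ _ (fun x : R => - x) expR);
  [exact: opp_continuous|exact: continuous_expR].
Qed.

Lemma integral_expRN (C : R) : 0 <= C ->
  (\int[mu]_(x in `[0%R, +oo[) (C * expR (- x))%:E = C%:E)%E.
Proof.
move=> C0.
have dF (x : R) : is_derive x 1 (fun y : R => - (C * expR (- y))) (C * expR (- x)).
  apply: is_derive_eq.
  by rewrite /GRing.scale/=; ring.
rewrite (@ge0_continuous_FTC2y _ _ (fun y : R => - (C * expR (- y))) 0 0).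
- by rewrite oppr0 expR0 mulr1 sub0e -EFinN opprK.
- by move=> x _; rewrite mulr_ge0// expR_ge0.
- by apply: continuous_subspaceT; exact: continuous_expRN.
- rewrite -oppr0 -(mulr0 C); apply: cvgN; apply: cvgM; first exact: cvg_cst.
  exact: cvgr_expR.
- by move=> x _; have [] := dF x.
- by apply: cvg_at_right_filter; apply: is_derive_continuous dF 0.
- by move=> x _; rewrite derive1E derive_val.
Qed.

Lemma integrable_expRN (C : R) (f : R -> R) : 0 <= C ->
  continuous f -> (forall x : R, 0 <= x -> `|f x| <= C * expR (- x)) ->
  mu.-integrable `[0, +oo[ (EFin \o f).
Proof.
move=> C0 cf fC.
apply: (@le_integrable _ _ _ mu _ _ _ (fun x => (C * expR (- x))%:E)) => //.
- by apply/measurable_EFinP; exact: measurable_funTS (continuous_measurable_fun cf).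
- move=> x /=; rewrite in_itv/= andbT => x0.
  by rewrite lee_fin (le_trans (fC _ x0))// ler_norm.
- apply/integrableP; split.
    apply/measurable_EFinP; apply: measurable_funTS.
    by apply: continuous_measurable_fun; exact: continuous_expRN.
  under eq_integral => x _ do rewrite gee0_abs ?lee_fin ?mulr_ge0 ?expR_ge0//.
  by rewrite integral_expRN// ltry.
Qed.

(** Adding [C * expR (- x)] makes the integrand nonnegative, so the fundamental theorem for
    nonnegative integrands applies to the sum; the integral [C] of the added term is then
    subtracted. *)
Lemma continuous_FTC2y_expRN (C l : R) (f F : R -> R) :
  continuous f -> (forall x : R, is_derive x 1 F (f x)) ->
  (forall x : R, 0 <= x -> `|f x| <= C * expR (- x)) -> F x @[x --> +oo] --> l ->
  (\int[mu]_(x in `[0%R, +oo[) (f x)%:E = (l - F 0)%:E)%E.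
Proof.
move=> cf dF fC Fl.
have C0 : 0 <= C.
  by have := fC 0 (lexx _); rewrite oppr0 expR0 mulr1; exact: le_trans.
have cg := @continuous_expRN C.
have If := integrable_expRN C0 cf fC.
have Ig : mu.-integrable `[0, +oo[ (EFin \o (fun x : R => C * expR (- x))).
  by apply: (integrable_expRN C0 cg) => x _; rewrite ger0_norm// mulr_ge0 ?expR_ge0.
have dG (x : R) : is_derive x 1 (fun y : R => F y - C * expR (- y)) (f x + C * expR (- x)).
  apply: is_derive_eq.
  by rewrite /GRing.scale/=; ring.
have : (\int[mu]_(x in `[0%R, +oo[) (f x + C * expR (- x))%:E = l%:E - (F 0 - C)%:E)%E.
  rewrite (@ge0_continuous_FTC2y _ _ (fun y : R => F y - C * expR (- y)) 0 l).
  - by rewrite oppr0 expR0 mulr1.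
  - by move=> x /fC; rewrite ler_norml => /andP[]; lra.
  - by apply: continuous_subspaceT => x; apply: cvgD; [exact: cf|exact: cg].
  - rewrite -[l]subr0 -(mulr0 C); apply: cvgB => //; apply: cvgM; first exact: cvg_cst.
    exact: cvgr_expR.
  - by move=> x _; have [] := dG x.
  - by apply: cvg_at_right_filter; apply: is_derive_continuous dG 0.
  - by move=> x _; rewrite derive1E derive_val.
under eq_integral do rewrite EFinD.
rewrite integralD// integral_expRN//.
have If_fin : (\int[mu]_(x in `[0%R, +oo[) (f x)%:E)%E \is a fin_num.
  by apply: integrable_fin_num => //; exact: If.
rewrite -(fineK If_fin) -EFinD -EFinB => -[rC]; congr EFin; lra.
Qed.

End exponential_decay.

(** * The hyperbolic tangent and the decay of sech ^ 2 *)

Section tanh.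
Variable R : realType.
Implicit Types x : R.

Definition tanh x := 1 - 2 * (expR (2 * x) + 1)^-1.

Lemma is_derive_tanh x : is_derive x 1 tanh (1 - tanh x ^+ 2).
Proof.
have E1 : expR (2 * x) + 1 != 0 by rewrite gt_eqF// addr_gt0 ?expR_gt0.
have dE : is_derive x 1 (fun y : R => expR (2 * y) + 1) (2 * expR (2 * x)).
  by apply: is_derive_eq; rewrite /GRing.scale/=; ring.
have dV : is_derive x 1 (fun y : R => (expR (2 * y) + 1)^-1)
    (- (expR (2 * x) + 1) ^- 2 * (2 * expR (2 * x))).
  have [dEx <-] := dE; split; first exact: derivableV.
  by rewrite deriveV.
apply: is_derive_eq; rewrite /tanh /GRing.scale/=; field.
exact: E1.
Qed.

Lemma tanh0 : tanh 0 = 0.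
Proof. by rewrite /tanh mulr0 expR0; field. Qed.

(** [1 - tanh x ^+ 2] stands for sech ^ 2 throughout; the closed form in [expR x] yields its
    positivity and decay. *)
Lemma sech2E x :
  1 - tanh x ^+ 2 = 4 * expR x ^+ 2 / (expR x ^+ 2 + 1) ^+ 2.
Proof.
rewrite /tanh expRM_natl; field.
by rewrite gt_eqF// addr_gt0 ?exprn_gt0 ?expR_gt0.
Qed.

Lemma sech2_gt0 x : 0 < 1 - tanh x ^+ 2.
Proof.
by rewrite sech2E divr_gt0 ?mulr_gt0 ?exprn_gt0 ?addr_gt0 ?exprn_gt0 ?expR_gt0.
Qed.

(** With [u = expR x] this amounts to [u ^ 4 <= (u ^ 2 + 1) ^ 2]. *)
Lemma sech2_le x : 1 - tanh x ^+ 2 <= 4 * expR (- x) ^+ 2.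
Proof.
have u0 := expR_gt0 x; have u2 : 0 < expR x ^+ 2 by rewrite exprn_gt0.
rewrite sech2E expRN ler_pdivrMr ?exprn_gt0 ?addr_gt0//.
rewrite -mulrA ler_pM2l// exprVn ler_pdivlMl//; nra.
Qed.

Lemma sech2_le_expRN x : 0 <= x -> 1 - tanh x ^+ 2 <= 4 * expR (- x).
Proof.
move=> x0; rewrite (le_trans (sech2_le x))// ler_pM2l// expr2.
by rewrite ler_piMr ?expR_ge0// -expR0 ler_expR oppr_le0.
Qed.

Lemma tanh_bound x : -1 <= tanh x <= 1.
Proof.
have := sech2_gt0 x; rewrite -ler_norml -(@ler_sqr _ `|tanh x|) ?nnegrE//.
by rewrite expr1n real_normK ?num_real//; lra.
Qed.

(** The value 3/4 exceeds [1 / sqrt 2], the positive zero of [2 T - 4 T ^ 3], so the weight has no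
    zero from 3 on. The bound comes from [1 + 2 x <= expR (2 * x)]. *)
Lemma tanh_ge34 x : 3 <= x -> 3 / 4 <= tanh x.
Proof.
move=> x3; have E7 : 7 <= expR (2 * x) by rewrite (le_trans _ (expR_ge1Dx _))//; lra.
rewrite /tanh lerBrDr -lerBrDl ler_pdivrMr; [|lra]; lra.
Qed.

End tanh.

(** * The potential, its regular solution and the antiderivative *)

Section example.
Variable R : realType.
Let mu := @lebesgue_measure R.
Implicit Types x k : R.

(** The Poeschl-Teller potential [- l (l + 1) sech ^ 2] for [l = 2], the first integer [l] with an
    odd bound state, that is, one vanishing at 0. *)
Definition potential x := - 6 * (1 - tanh x ^+ 2).

(** With [T = tanh x], the imaginary part of the solution [(1 + k ^ 2 - 3 T ^ 2 + 3 i k T) exp (i k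
    x)], divided by its slope [k (k ^ 2 + 4)] at 0. *)
Definition phi x k := ((1 + k ^+ 2 - 3 * tanh x ^+ 2) * sin (k * x)
   + 3 * k * tanh x * cos (k * x)) / (k * (k ^+ 2 + 4)).

Definition dphi x k := ((6 * tanh x ^+ 3 - (6 + 3 * k ^+ 2) * tanh x) * sin (k * x)
   + k * (k ^+ 2 + 4 - 6 * tanh x ^+ 2) * cos (k * x)) / (k * (k ^+ 2 + 4)).

(** The inverse of [k * (k ^+ 2 + 4)] enters as a constant factor, so [k = 0], where this inverse is
    0, is covered as well. *)
Lemma is_derive_phi x k : is_derive x 1 (phi ^~ k) (dphi x k).
Proof.
rewrite /phi /dphi; have dT := is_derive_tanh x.
apply: is_derive_eq; rewrite /GRing.scale/=; ring.
Qed.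

Lemma is_derive_dphi x k : is_derive x 1 (dphi ^~ k) ((potential x - k ^+ 2) * phi x k).
Proof.
rewrite /phi /dphi /potential; have dT := is_derive_tanh x.
apply: is_derive_eq; rewrite /GRing.scale/=; ring.
Qed.

(* [(psi ^ 2)'] for the bound state [psi = tanh sech]. *)
Definition weight x := (2 * tanh x - 4 * tanh x ^+ 3) * (1 - tanh x ^+ 2).

(* Half of [psi ^ 2 phi ^ 2 + W ^ 2 / (1 + k ^ 2)], with [sech ^ 2] factored out;
   here [psi' = (1 - 2 tanh ^ 2) sech]. *)
Definition antiderivative x k := (1 - tanh x ^+ 2) / 2 *
  (tanh x ^+ 2 * phi x k ^+ 2 +
   (tanh x * dphi x k - (1 - 2 * tanh x ^+ 2) * phi x k) ^+ 2 / (1 + k ^+ 2)).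

(** Only the differential equations of [tanh], [phi] and [dphi] enter, not their closed forms; what
    remains is an algebraic identity in their values. *)
Lemma is_derive_antiderivative x k :
  is_derive x 1 (antiderivative ^~ k) (weight x * phi x k * phi x k).
Proof.
have dT := is_derive_tanh x.
have dp := is_derive_phi x k; have ddp := is_derive_dphi x k.
rewrite /antiderivative /weight.
apply: is_derive_eq; rewrite /GRing.scale/= /potential; field.
by rewrite gt_eqF// ltr_pwDl// sqr_ge0.
Qed.

Lemma norm_lincomb (a b A B s c : R) :
  `|a| <= A -> `|b| <= B -> `|s| <= 1 -> `|c| <= 1 -> `|a * s + b * c| <= A + B.
Proof.
move=> aA bB s1 c1; rewrite (le_trans (ler_normD _ _))// !normrM.
by rewrite lerD// -[leRHS]mulr1 ler_pM.
Qed.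

(** A crude common bound: [12 + 3 k ^ 2] and [k (k ^ 2 + 10)] dominate the coefficients of [sin] and
    [cos] in [dphi], and their sum exceeds the bound [4 + k ^ 2 + 3 k] for [phi]. *)
Definition phi_sup k := (12 + 3 * k ^+ 2 + k * (k ^+ 2 + 10)) / (k * (k ^+ 2 + 4)).

Lemma phi_bound x k : 0 < k -> `|phi x k| <= phi_sup k.
Proof.
move=> k0; have N0 : 0 < k * (k ^+ 2 + 4) by rewrite mulr_gt0// ltr_wpDl// sqr_ge0.
have /andP[T1 T2] := tanh_bound x; have T3 := sech2_gt0 x.
rewrite /phi /phi_sup normrM (gtr0_norm (_ : 0 < _^-1)) ?invr_gt0// ler_pM2r ?invr_gt0//.
have k20 := sqr_ge0 k; have kk20 : 0 <= k * k ^+ 2 by rewrite mulr_ge0// ltW.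
apply: (@le_trans _ _ ((4 + k ^+ 2) + 3 * k)); last nra.
apply: norm_lincomb; rewrite ?ler_norml ?sin_le1 ?sin_geN1 ?cos_le1 ?cos_geN1//; nra.
Qed.

Lemma dphi_bound x k : 0 < k -> `|dphi x k| <= phi_sup k.
Proof.
move=> k0; have N0 : 0 < k * (k ^+ 2 + 4) by rewrite mulr_gt0// ltr_wpDl// sqr_ge0.
have /andP[T1 T2] := tanh_bound x; have T3 := sech2_gt0 x.
have k20 := sqr_ge0 k.
rewrite /dphi /phi_sup normrM (gtr0_norm (_ : 0 < _^-1)) ?invr_gt0// ler_pM2r ?invr_gt0//.
have T0 := sqr_ge0 (tanh x).
apply: norm_lincomb; rewrite ?ler_norml ?sin_le1 ?sin_geN1 ?cos_le1 ?cos_geN1//.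
  rewrite (_ : 6 * _ ^+ 3 - _ = - tanh x * (6 * (1 - tanh x ^+ 2) + 3 * k ^+ 2)); last by ring.
  by rewrite -ler_norml normrM normrN -[leRHS]mul1r ler_pM ?ler_norml ?T1 ?T2//; lra.
nra.
Qed.

Lemma phi0 k : phi 0 k = 0.
Proof. by rewrite /phi tanh0 !mulr0 sin0; ring. Qed.

Lemma dphi0 k : 0 < k -> dphi 0 k = 1.
Proof.
move=> k0; rewrite /dphi tanh0 !mulr0 cos0 sin0; field.
by rewrite !gt_eqF// ltr_wpDl// sqr_ge0.
Qed.

Lemma antiderivative0 k : antiderivative 0 k = 0.
Proof. by rewrite /antiderivative phi0 tanh0; ring. Qed.

Lemma regular_solution_phi k : 0 < k -> regular_solution potential k (phi ^~ k).
Proof.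
move=> k0.
have pot6 x : `|potential x| <= 6.
  have T3 := sech2_gt0 x; have T0 := sqr_ge0 (tanh x).
  by rewrite /potential ler_norml; apply/andP; split; lra.
have Sphi : solves_regular_ivp potential k (phi ^~ k).
  apply: (@solves_regular_ivp_classical _ _ _ ((6 + k ^+ 2) * phi_sup k) _ (dphi ^~ k)).
  - by move=> x; exact: is_derive_phi.
  - by move=> x; exact: is_derive_dphi.
  - move=> x; rewrite normrM ler_pM ?phi_bound// (le_trans (ler_normB _ _))//.
    by rewrite lerD// ger0_norm ?sqr_ge0.
  - exact: phi0.
  - exact: dphi0.
split=> // psi; apply: (@regular_ivp_unique _ potential 6) => // x _; exact: pot6.
Qed.

(** * Decay estimates, integrability and orthogonality of the weight *)

Lemma weight_le x : `|weight x| <= 6 * (1 - tanh x ^+ 2).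
Proof.
have T3 := sech2_gt0 x; have /andP[T1 T2] := tanh_bound x; have T0 := sqr_ge0 (tanh x).
rewrite /weight normrM (gtr0_norm T3) ler_pM2r// ler_norml.
by apply/andP; split; nra.
Qed.

(** Since [phi] and [dphi] are bounded by [B], the bracket is at most [B ^ 2 + (2 B) ^ 2]. The
    factor sech ^ 2 / 2 is at most [2 * expR (- x)], whence the majorant
    [10 * B ^+ 2 * expR (- x)]. *)
Lemma antiderivative_cvg0 k : 0 < k -> antiderivative x k @[x --> +oo] --> 0.
Proof.
move=> k0; pose B := phi_sup k.
have B0 : 0 <= B by rewrite (le_trans _ (phi_bound 0 k0)).
have k2 : 1 <= 1 + k ^+ 2 by rewrite lerDl sqr_ge0.
have GB x : 0 <= antiderivative x k <= (1 - tanh x ^+ 2) / 2 * (5 * B ^+ 2).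
  have T3 := sech2_gt0 x; have /andP[T1 T2] := tanh_bound x; have T0 := sqr_ge0 (tanh x).
  have T4 : 0 < (1 - tanh x ^+ 2) / 2 by lra.
  have p2 : phi x k ^+ 2 <= B ^+ 2.
    by rewrite -[leLHS]real_normK ?num_real// ler_sqr ?nnegrE ?phi_bound.
  have w2 : (tanh x * dphi x k - (1 - 2 * tanh x ^+ 2) * phi x k) ^+ 2 <= (2 * B) ^+ 2.
    rewrite -[leLHS]real_normK ?num_real// ler_sqr ?nnegrE//; last lra.
    rewrite (le_trans (ler_normB _ _))// (normrM (tanh x)) (normrM (1 - _)).
    rewrite (_ : 2 * B = B + B); last by ring.
    rewrite lerD// -[leRHS]mul1r ler_pM ?phi_bound ?dphi_bound//.
      by rewrite ler_norml T1.
    by rewrite ler_norml; lra.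
  rewrite /antiderivative; apply/andP; split.
    apply: mulr_ge0; first exact: ltW.
    apply: addr_ge0; first by rewrite mulr_ge0 ?sqr_ge0.
    by apply: divr_ge0; [exact: sqr_ge0|lra].
  rewrite ler_pM2l// (_ : 5 * B ^+ 2 = B ^+ 2 + (2 * B) ^+ 2); last by ring.
  rewrite lerD//.
    by rewrite -[leRHS]mul1r ler_pM ?sqr_ge0//; lra.
  by rewrite ler_pdivrMr; [rewrite (le_trans w2)// ler_peMr// sqr_ge0|lra].
have cE : 10 * B ^+ 2 * expR (- x) @[x --> +oo] --> (0 : R).
  rewrite -(mulr0 (10 * B ^+ 2)); apply: cvgM; first exact: cvg_cst.
  exact: cvgr_expR.
apply: (@squeeze_cvgr _ _ _ _ (cst 0) (fun x => 10 * B ^+ 2 * expR (- x))) => //.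
  near=> x; have /andP[-> /le_trans] /= := GB x; apply.
  have x0 : 0 <= x by near: x; exact: nbhs_pinfty_ge.
  have := sech2_le_expRN x0; have := sqr_ge0 B; nra.
exact: cvg_cst.
Unshelve. all: by end_near. Qed.

Lemma continuous_tanh : continuous (@tanh R).
Proof. exact: is_derive_continuous (@is_derive_tanh R). Qed.

Lemma continuous_sech2 : continuous (fun x : R => 1 - tanh x ^+ 2).
Proof.
move=> x; apply: cvgB; first exact: cvg_cst.
by apply: cvgM; exact: continuous_tanh.
Qed.

Lemma continuous_potential : continuous potential.
Proof. by move=> x; apply: cvgM; [exact: cvg_cst|exact: continuous_sech2]. Qed.

Lemma continuous_weight : continuous weight.
Proof.
move=> x; apply: cvgM; last exact: continuous_sech2.
have T := @continuous_tanh x.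
by apply: cvgB; (apply: cvgM; first exact: cvg_cst) => //; do 2 apply: cvgM => //.
Qed.

Lemma potential_normE (x : R) : `|potential x| = 6 * (1 - tanh x ^+ 2).
Proof. by rewrite /potential normrM normrN (gtr0_norm (sech2_gt0 x)) ger0_norm. Qed.

Lemma integral_abs_lty (C : R) (f : R -> R) : 0 <= C -> continuous f ->
  (forall x : R, 0 <= x -> 0 <= f x <= C * expR (- x)) ->
  (\int[mu]_(x in `[0%R, +oo[) (f x)%:E < +oo)%E.
Proof.
move=> C0 cf fC.
have /integrableP[_] : mu.-integrable `[0, +oo[ (EFin \o f).
  apply: (integrable_expRN C0 cf) => x /fC /andP[f0 fle].
  by rewrite ger0_norm.
apply: le_lt_trans; apply: ge0_le_integral => //=.
- by move=> x; rewrite in_itv/= andbT lee_fin => /fC /andP[].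
- by apply/measurable_EFinP; exact: measurable_funTS (continuous_measurable_fun cf).
- apply/measurable_EFinP; apply: measurableT_comp => //.
  exact: measurable_funTS (continuous_measurable_fun cf).
- by move=> x _; rewrite lee_fin ler_norm.
Qed.

Lemma L11_potential : L11 potential.
Proof.
have cn : continuous (fun x : R => `|potential x|).
  by move=> x; apply: continuous_comp; [exact: continuous_potential|exact: norm_continuous].
split.
- exact: measurable_funTS (continuous_measurable_fun continuous_potential).
- apply: (@integral_abs_lty 24) => //.
    move=> x; apply: cvgM; last exact: cn.
    by apply: cvgD; [exact: cvg_cst|exact: cvg_id].
  move=> x x0; have S0 := sech2_gt0 x; rewrite potential_normE; apply/andP; split.
    by apply: mulr_ge0; [exact: addr_ge0|rewrite mulr_ge0// ltW].
  (* The decay [expR (- x) ^+ 2] is used in full: one factor absorbs [1 + x <= expR x], the other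
     remains. *)
  have := sech2_le x; have := expR_ge1Dx x; rewrite expRN => ux uS.
  have u0 := expR_gt0 x.
  apply: (@le_trans _ _ (expR x * (6 * (4 * (expR x)^-1 ^+ 2)))).
    by apply: ler_pM => //; [exact: addr_ge0|rewrite mulr_ge0// ltW|rewrite ler_pM2l].
  by rewrite le_eqVlt; apply/orP; left; apply/eqP; field; rewrite gt_eqF.
- move=> a.
  (* The square is integrable on the whole half-line: [36 sech ^ 4 <= 36 sech ^ 2 <= 144 expR (-
     x)]. *)
  apply: (@le_lt_trans _ _ (\int[mu]_(x in `[0%R, +oo[) (`|potential x| ^+ 2)%:E)%E).
    apply: ge0_subset_integral => //=.
    + apply/measurable_EFinP; apply: measurable_funTS.
      by apply: continuous_measurable_fun => x; apply: cvgM; exact: cn.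
    + by move=> x /=; rewrite !in_itv/= andbT => /andP[/ltW].
  apply: (@integral_abs_lty 144) => //; first by move=> x; apply: cvgM; exact: cn.
  move=> x x0; rewrite sqr_ge0/= potential_normE.
  have := sech2_le_expRN x0; have := sech2_gt0 x; have := sqr_ge0 (tanh x); nra.
Qed.

Lemma L1_weight : L1 weight.
Proof.
apply: (@integrable_expRN _ 24) => //; first exact: continuous_weight.
move=> x x0; rewrite (le_trans (weight_le x))//.
by have := sech2_le_expRN x0; lra.
Qed.

(** On []3, 4[] the bound [tanh x >= 3 / 4] makes [2 T - 4 T ^ 3] negative, and an interval of
    length 1 does not fit into a null set. *)
Lemma weight_not_null : ~ null_on_halfline weight.
Proof.
move=> [N [mN N0 badN]].
have sub : `]3%R, 4%R[%classic `<=` N.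
  move=> x /=; rewrite in_itv/= => /andP[x3 _]; apply: badN => /= H.
  have T := tanh_ge34 (ltW x3); have S := sech2_gt0 x.
  have /H : 0 <= x by lra.
  rewrite /weight => /eqP; rewrite mulf_eq0 (gt_eqF S) orbF => /eqP.
  nra.
have : (mu `]3%R, 4%R[ <= mu N)%E by apply: le_measure; rewrite ?inE.
rewrite [X in (_ <= X)%E]N0 /mu lebesgue_measure_itv/= lte_fin.
have -> : (3 < 4 :> R) = true by apply/idP; lra.
by rewrite -EFinB lee_fin; lra.
Qed.

Lemma integral_weight_phi (k : R) : 0 < k ->
  (\int[mu]_(x in `[0%R, +oo[) (weight x * phi x k * phi x k)%:E = 0)%E.
Proof.
move=> k0; have B0 : 0 <= phi_sup k by rewrite (le_trans _ (phi_bound 0 k0)).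
have cphi : continuous (phi ^~ k).
  exact: is_derive_continuous (fun x => is_derive_phi x k).
transitivity (0 - antiderivative 0 k)%:E; last by rewrite antiderivative0 subrr.
(* The weight is at most [6 * 4 * expR (- x)], and each factor [phi] at most [phi_sup k]. *)
apply: (@continuous_FTC2y_expRN _ (24 * phi_sup k ^+ 2) 0 _ (antiderivative ^~ k)).
- move=> x; apply: cvgM; last exact: cphi.
  by apply: cvgM; [exact: continuous_weight|exact: cphi].
- by move=> x; exact: is_derive_antiderivative.
- move=> x x0; rewrite 2!normrM.
  apply: (@le_trans _ _ (24 * expR (- x) * phi_sup k * phi_sup k)); last first.
    by rewrite le_eqVlt; apply/orP; left; apply/eqP; ring.
  apply: ler_pM; rewrite ?phi_bound// ler_pM ?phi_bound//.
  rewrite (le_trans (weight_le x))//.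
  by have := sech2_le_expRN x0; lra.
- exact: antiderivative_cvg0.
Qed.

End example.

Theorem theorem2p2p2 (R : realType) :
  exists q1 q2 h : R -> R,
    [/\ L11 q1, L11 q2, L1 h & ~ null_on_halfline h] /\
    exists phi1 phi2 : R -> R -> R,
      [/\ forall k : R, 0 < k -> regular_solution q1 k (phi1 ^~ k),
          forall k : R, 0 < k -> regular_solution q2 k (phi2 ^~ k)
        & forall k : R, 0 < k ->
            (\int[@lebesgue_measure R]_(x in `[0%R, +oo[)
               (h x * phi1 x k * phi2 x k)%:E = 0)%E].
Proof.
exists (@potential R), (@potential R), (@weight R); split.
  split; [exact: L11_potential|exact: L11_potential|exact: L1_weight|exact: weight_not_null].
exists (@phi R), (@phi R); split; try exact: regular_solution_phi.
exact: integral_weight_phi.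
Qed.
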